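(* Let $k\ge 2$ be an integer and set \[ \alpha_k:=\frac{(k-2)\sqrt{k+1}+2}{2k(k-1)}. \] For every simple undirected graph $G$ on $n$ vertices, \[ \lambda_k(G)\le \alpha_k n-1 . \] Consequently, $c_k\le \alpha_k$, where \[ c_k:=\sup\left\{\frac{\lambda_k(G)}{|V(G)|}:\ G \text{ a graph with } |V(G)|\ge k\right\}. \]
   Context: For a simple undirected graph $G$ on $n$ vertices, $\lambda_1(G)\ge \lambda_2(G)\ge\cdots\ge\lambda_n(G)$ denote the eigenvalues of its adjacency matrix (listed with multiplicity), and $\lambda_k(G)$ is the $k$-th largest of them. *)

(* Defs.v *)
From HB Require Import structures.
From mathcomp Require Import all_boot all_order all_algebra.
From mathcomp Require Import complex.
From mathcomp Require Import all_classical all_reals ereal.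

Set Implicit Arguments.
Unset Strict Implicit.
Unset Printing Implicit Defensive.

Import Order.TTheory GRing.Theory Num.Theory.
Local Open Scope ring_scope.
Local Open Scope classical_set_scope.

Record sgraph := SGraph {
  vertex :> finType;
  adj : rel vertex;
  adj_sym : symmetric adj;
  adj_irr : irreflexive adj }.

(* The vertices are indexed by their position in [enum G]; the spectrum does
   not depend on this enumeration. *)
Definition adjmx (R : realType) (G : sgraph) : 'M[R]_#|G| :=
  \matrix_(i, j) (adj (enum_val i) (enum_val j))%:R.

Definition is_spectrum (R : realType) n (A : 'M[R]_n) (s : seq R) : Prop :=
  sorted >=%R s /\ char_poly A = \prod_(x <- s) ('X - x%:P).

(* The list is unique (is_spectrum_inj), and it exists for every symmetric
   matrix (spectrumP), so [::] is never used as a default for a graph. *)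
Definition spectrum (R : realType) n (A : 'M[R]_n) : seq R :=
  xget [::] [set s | is_spectrum A s].

(* k-th largest eigenvalue, counted from k = 1; meaningful for 1 <= k <= #|G|. *)
Definition lambda (R : realType) (k : nat) (G : sgraph) : R :=
  (spectrum (adjmx R G))`_k.-1.

Definition alpha (R : realType) (k : nat) : R :=
  ((k%:R - 2) * Num.sqrt (k%:R + 1) + 2) / (2 * k%:R * (k%:R - 1)).

Definition eigenratios (R : realType) (k : nat) : set R :=
  [set x | exists2 G : sgraph, (k <= #|G|)%N & x = lambda R k G / #|G|%:R].
Arguments eigenratios : clear implicits.

(* The supremum is taken in the extended reals, so that no boundedness is
   presupposed and no default value can occur. *)
Definition c_ (R : realType) (k : nat) : \bar R :=
  ereal_sup (EFin @` eigenratios R k).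

Lemma is_spectrum_inj (R : realType) n (A : 'M[R]_n) s t :
  is_spectrum A s -> is_spectrum A t -> s = t.
Proof.
move=> [ss es] [st et].
apply: (sorted_eq _ _ ss st).
- exact: ge_trans.
- exact: ge_anti.
by apply: prod_XsubC_eq; rewrite -es -et.
Qed.

Lemma is_spectrum_size (R : realType) n (A : 'M[R]_n) s :
  is_spectrum A s -> size s = n.
Proof.
move=> [_ es]; have := size_char_poly A.
by rewrite es size_prod_XsubC => -[].
Qed.

Lemma char_poly_conj (F : fieldType) n (A D P : 'M[F]_n) :
  P \in unitmx -> A = invmx P *m D *m P -> char_poly A = char_poly D.
Proof.
move=> Pu ->; rewrite /char_poly.
have -> : char_poly_mx (invmx P *m D *m P) =
   map_mx polyC (invmx P) *m char_poly_mx D *m map_mx polyC P.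
  rewrite /char_poly_mx !map_mxM mulmxBr mulmxBl; congr (_ - _).
  by rewrite scalar_mxC -mulmxA -map_mxM mulVmx// map_mx1 mulmx1.
rewrite !det_mulmx mulrAC -det_mulmx -map_mxM mulVmx// map_mx1 det1.
by rewrite mul1r.
Qed.

Lemma symmetric_is_spectrum (R : realType) n (A : 'M[R]_n) :
  A^T = A -> exists s, is_spectrum A s.
Proof.
move=> As; pose f := real_complex R.
pose B := map_mx f A.
have Br : B \is a mxOver Num.real.
  by apply/mxOverP => i j; rewrite mxE; apply/complex_realP; exists (A i j).
have Bs : B \is symmetricmx.
  by apply/is_hermitianmxP; rewrite scale1r map_mx_id// /B map_trmx As.
have Bh := realsym_hermsym Bs Br.
have /orthomx_spectralP Be := hermitian_normalmx Bh.
have dr := hermitian_spectral_diag_real Bh.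
pose s := [seq complex.Re (spectral_diag B 0 i) | i <- enum 'I_n].
exists (sort >=%R s); split; first exact/sort_sorted/ge_total.
have -> : \prod_(x <- sort >=%R s) ('X - x%:P) = \prod_(x <- s) ('X - x%:P).
  by apply: perm_big; rewrite perm_sort.
apply: (@map_poly_inj _ _ f).
rewrite map_char_poly -/B (char_poly_conj (spectral_unit B) Be).
rewrite char_poly_trig; last by rewrite diag_mx_is_trig.
rewrite rmorph_prod /= /s big_map big_enum /=.
apply: eq_bigr => i _; rewrite rmorphB /= map_polyX map_polyC /= mxE eqxx mulr1n.
congr (_ - _%:P).
by apply/esym; rewrite /f RRe_real//; exact: (mxOverP dr).
Qed.

Lemma spectrumP (R : realType) n (A : 'M[R]_n) :
  A^T = A -> is_spectrum A (spectrum A).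
Proof. by move=> As; exact: (xgetPex [::] (symmetric_is_spectrum As)). Qed.

Lemma adjmx_sym (R : realType) (G : sgraph) : (adjmx R G)^T = adjmx R G.
Proof. by apply/matrixP => i j; rewrite !mxE adj_sym. Qed.

Lemma eigenratios_neq0 (R : realType) (k : nat) : eigenratios R k !=set0.
Proof.
have es : symmetric (fun _ _ : 'I_k => false) by [].
have ei : irreflexive (fun _ _ : 'I_k => false) by [].
pose G := SGraph es ei.
by exists (lambda R k G / #|G|%:R), G; rewrite ?card_ord.
Qed.

(* Main.v *)
Require Import Defs.
From mathcomp Require Import all_boot all_order all_algebra.
From mathcomp Require Import all_classical all_reals ereal.
From mathcomp Require Import ring lra.

(**
Within the span of the top k eigenvectors of the adjacency matrix A there are
m = k - 1 orthonormal vectors orthogonal to the all-ones vector; let U be the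
m x n matrix with these rows. The matrix S = 2A + 2I - J has entries +1 and -1
and U J = 0, so 2m (lambda_k + 1) <= tr (U S U^T) <= sum_ij |<u_i, u_j>|, where
u_1, ..., u_n are the columns of U, which satisfy sum_i u_i u_i^T = I_m.

It remains to bound this last sum for every such family. Write u_i = s_i x_i
with x_i a unit vector, t = <x_i, x_j> and tau = 1/sqrt(m + 2). On [-1, 1] the
function |t| lies below an even quartic in t that is tangent to it at |t| = tau
and meets it at |t| = 1 (the values taken by a maximal system of equiangular
lines). Summing with weights s_i s_j, the quartic term is controlled by
sum s_i s_j t^4 >= 3 (sum s_i)^2 / (m (m + 2)), and then AM-GM,
s_i s_j <= (s_i^2 + s_j^2) / 2, brings in the isotropy relation for the
remaining two terms, whose coefficients are nonnegative as soon as m >= 2.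
For m = 1 the bound is plain AM-GM.
*)

Set Implicit Arguments.
Unset Strict Implicit.
Unset Printing Implicit Defensive.

Import Order.TTheory GRing.Theory Num.Theory.
Local Open Scope ring_scope.

(** * Isotropic families of vectors *)

(** With [y] for [|t|], the difference of the sides is [(y - tau) ^+ 2 * (1 - y) * (y + 1 + 2 *
    tau)]: a double root for the tangency, a root at [1], and a last factor chosen to cancel the
    cubic term. *)
Lemma normr_le_quartic (R : realFieldType) (tau t : R) :
  0 <= tau -> `|t| <= 1 ->
  2 * tau * (1 + tau) ^+ 2 * `|t| <=
  tau ^+ 2 * (1 + 2 * tau) + (1 + 2 * tau + 3 * tau ^+ 2) * t ^+ 2 - t ^+ 4.
Proof.
move=> tau0 t1; have y0 := normr_ge0 t.
have -> : t ^+ 4 = `|t| ^+ 4 by rewrite -normrX ger0_norm ?exprn_even_ge0.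
rewrite -(real_normK (num_real t)); set y := `|t| in t1 y0 *.
rewrite -subr_ge0.
have : 0 <= (y - tau) ^+ 2 * ((1 - y) * (y + 1 + 2 * tau)).
  by rewrite mulr_ge0 ?sqr_ge0// mulr_ge0//; lra.
by congr (0 <= _); ring.
Qed.

Section FourthMoment.
Context {R : realFieldType} {m : nat}.
Implicit Types V : 'I_m -> 'I_m -> 'I_m -> 'I_m -> R.

Let delta (a b : 'I_m) : R := (a == b)%:R.
(** This is [m (m + 2)] times the fourth moment tensor of the uniform measure on the unit sphere. *)
Let sym4 a b c d := delta a b * delta c d + delta a c * delta b d +
  delta a d * delta b c.

Let sum_delta (F : 'I_m -> R) a : \sum_b F b * delta a b = F a.
Proof.
rewrite (bigD1 a)//= /delta eqxx mulr1 big1 ?addr0// => b /negbTE.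
by rewrite eq_sym => ->; rewrite mulr0.
Qed.

Lemma sum_sym4 V :
  \sum_a \sum_b \sum_c \sum_d V a b c d * sym4 a b c d =
  \sum_a \sum_b (V a a b b + V a b a b + V a b b a).
Proof.
under eq_bigr do under eq_bigr do under eq_bigr do
  under eq_bigr do rewrite /sym4 !mulrDr.
under eq_bigr do under eq_bigr do under eq_bigr do rewrite !big_split/=.
under eq_bigr do under eq_bigr do rewrite !big_split/=.
under eq_bigr do rewrite !big_split/=.
under [RHS]eq_bigr do rewrite !big_split/=.
rewrite !big_split/=; congr (_ + _ + _); apply: eq_bigr => a _.
- rewrite -(sum_delta (fun b => \sum_c V a b c c)); apply: eq_bigr => b _.
  rewrite mulr_suml; apply: eq_bigr => c _.
  rewrite -(sum_delta (fun d => V a b c d)) mulr_suml.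
  by apply: eq_bigr => d _; rewrite mulrAC mulrA.
- apply: eq_bigr => b _.
  rewrite -(sum_delta (fun c => V a b c b)); apply: eq_bigr => c _.
  rewrite -(sum_delta (fun d => V a b c d)) mulr_suml.
  by apply: eq_bigr => d _; rewrite mulrAC mulrA.
- apply: eq_bigr => b _.
  rewrite -(sum_delta (fun c => V a b c a)); apply: eq_bigr => c _.
  rewrite -(sum_delta (fun d => V a b c d)) mulr_suml.
  by apply: eq_bigr => d _; rewrite mulrA.
Qed.

Lemma sum_sym4_sq :
  \sum_a \sum_b \sum_c \sum_d sym4 a b c d * sym4 a b c d =
  3 * m%:R * (m%:R + 2).
Proof.
rewrite sum_sym4.
have E a b : sym4 a a b b + sym4 a b a b + sym4 a b b a =
    3 + 6 * delta a b.
  rewrite /sym4 /delta !eqxx [b == a]eq_sym.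
  by case: (a == b) => /=; ring.
under eq_bigr do under eq_bigr do rewrite E.
under eq_bigr do rewrite big_split/= sumr_const card_ord (sum_delta (fun=> 6)).
by rewrite sumr_const card_ord -(mulr_natr (_ + _)) -(mulr_natr 3 m); ring.
Qed.

Let sum4 (f : 'I_m -> R) C :
  \sum_a \sum_b \sum_c \sum_d C * (f a * f b * f c * f d) =
  C * (\sum_a f a) ^+ 4.
Proof.
under eq_bigr do under eq_bigr do under eq_bigr do rewrite -!mulr_sumr.
under eq_bigr do under eq_bigr do rewrite -mulr_sumr -mulr_suml -!mulr_sumr.
under eq_bigr do rewrite -mulr_sumr -!mulr_suml -!mulr_sumr.
rewrite -mulr_sumr -!mulr_suml; ring.
Qed.

(** Cauchy-Schwarz between the weighted moment tensor [T] of the family and [sym4]: [<T, T>] is the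
    double sum, [<T, sym4>] is [3 * rho], and [<sym4, sym4>] is [3 m (m + 2)]. The hypothesis makes
    [x i] a unit vector wherever [s i] is nonzero. *)
Lemma fourth_moment_ge (I : finType) (s : I -> R) (x : I -> 'I_m -> R) :
  (0 < m)%N -> (forall i, s i * \sum_a x i a ^+ 2 = s i) ->
  3 * (\sum_i s i) ^+ 2 <=
  m%:R * (m%:R + 2) *
  \sum_i \sum_j s i * s j * (\sum_a x i a * x j a) ^+ 4.
Proof.
move=> m0 xs; set rho := \sum_i s i.
set Q := \sum_i \sum_j _.
have M0 : 0 < m%:R * (m%:R + 2) :> R.
  by rewrite mulr_gt0 ?ltr0n// addr_gt0// ltr0n.
pose K : R := m%:R * (m%:R + 2).
pose T a b c d := \sum_i s i * (x i a * x i b * x i c * x i d).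
have TT : \sum_a \sum_b \sum_c \sum_d T a b c d * T a b c d = Q.
  transitivity (\sum_a \sum_b \sum_c \sum_d \sum_i \sum_j s i * s j *
     ((x i a * x j a) * (x i b * x j b) * (x i c * x j c) * (x i d * x j d))).
    do 4!apply: eq_bigr => ? _; rewrite /T mulr_suml; apply: eq_bigr => i _.
    by rewrite mulr_sumr; apply: eq_bigr => j _; ring.
  (* Once the sums over [i] and [j] are outermost, the four coordinate sums factor into a fourth
     power. *)
  under eq_bigr do under eq_bigr do under eq_bigr do rewrite exchange_big/=.
  under eq_bigr do under eq_bigr do rewrite exchange_big/=.
  under eq_bigr do rewrite exchange_big/=.
  rewrite exchange_big/=; apply: eq_bigr => i _.
  under eq_bigr do under eq_bigr do under eq_bigr do rewrite exchange_big/=.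
  under eq_bigr do under eq_bigr do rewrite exchange_big/=.
  under eq_bigr do rewrite exchange_big/=.
  rewrite exchange_big/=; apply: eq_bigr => j _.
  exact: (sum4 (fun a => x i a * x j a)).
have TD : \sum_a \sum_b \sum_c \sum_d T a b c d * sym4 a b c d = 3 * rho.
  rewrite sum_sym4.
  transitivity (\sum_a \sum_b \sum_i 3 * (s i * (x i a ^+ 2 * x i b ^+ 2))).
    apply: eq_bigr => a _; apply: eq_bigr => b _.
    by rewrite /T -!big_split/=; apply: eq_bigr => i _; ring.
  under eq_bigr do rewrite exchange_big/=.
  rewrite exchange_big/= mulr_sumr; apply: eq_bigr => i _.
  (* The normalization is used twice, once for each of the sums over [a] and [b]. *)
  rewrite -{2}(xs i) -{2}(xs i) -mulrA mulr_suml !mulr_sumr.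
  apply: eq_bigr => a _; rewrite !mulr_sumr.
  by apply: eq_bigr => b _; ring.
clearbody rho.
(* On a spherical 4-design K T = rho sym4, so this loses nothing there. *)
have : 0 <= \sum_a \sum_b \sum_c \sum_d (K * T a b c d - rho * sym4 a b c d) ^+ 2.
  by do 4!(apply: sumr_ge0 => ? _); exact: sqr_ge0.
have -> : \sum_a \sum_b \sum_c \sum_d (K * T a b c d - rho * sym4 a b c d) ^+ 2
   = K * (K * Q - 3 * rho ^+ 2).
  transitivity (K ^+ 2 * Q - 2 * K * rho * (3 * rho) +
                rho ^+ 2 * (3 * m%:R * (m%:R + 2))); last by rewrite /K; ring.
  rewrite -TT -TD -sum_sym4_sq.
  rewrite -mulNr; do 4!(rewrite !mulr_sumr -!big_split/=; apply: eq_bigr => ? _).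
  by ring.
by rewrite pmulr_rge0// subr_ge0.
Qed.
End FourthMoment.

Lemma mul_le_half_sq (R : realFieldType) (a b : R) :
  a * b <= (a ^+ 2 + b ^+ 2) / 2.
Proof. have := sqr_ge0 (a - b); rewrite sqrrB => h; lra. Qed.

Lemma normr_mul_le_half_sq (R : realFieldType) (a b : R) :
  `|a * b| <= (a ^+ 2 + b ^+ 2) / 2.
Proof.
rewrite normrM; apply: le_trans (mul_le_half_sq _ _) _.
by rewrite !real_normK ?num_real.
Qed.

Section IsotropicVectors.
Context {R : rcfType} {m n : nat} (U : 'M[R]_(m, n)) (UU : U *m U^T = 1%:M).

(** Parseval's identity for the tight frame formed by the columns of [U]. *)
Lemma isotropic_isometry (y : 'I_m -> R) :
  \sum_i (\sum_a U a i * y a) ^+ 2 = \sum_a y a ^+ 2.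
Proof.
pose Y := \row_a y a.
have -> : \sum_a y a ^+ 2 = (Y *m Y^T) 0 0.
  by rewrite mxE; apply: eq_bigr => a _; rewrite !mxE expr2.
rewrite -[Y in Y *m _]mulmx1 -UU mulmxA -mulmxA -trmx_mul mxE.
apply: eq_bigr => i _; rewrite [(Y *m U)^T i 0]mxE -expr2 mxE.
by congr (_ ^+ 2); apply: eq_bigr => a _; rewrite mxE mulrC.
Qed.

Lemma isotropic_total_norm : \sum_i \sum_a U a i ^+ 2 = m%:R.
Proof.
rewrite -(mxtrace1 R m) -UU exchange_big/= /mxtrace; apply: eq_bigr => a _.
by rewrite mxE; apply: eq_bigr => i _; rewrite mxE expr2.
Qed.

Lemma sum_half_sq (F : 'I_n -> R) :
  \sum_i \sum_j (F i + F j) / 2 = n%:R * \sum_i F i.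
Proof.
under eq_bigr do rewrite -mulr_suml big_split/= sumr_const card_ord.
rewrite -mulr_suml big_split/= sumr_const card_ord sumrMnl.
by rewrite -(mulr_natl (\sum_i F i) n); field.
Qed.

Lemma sum_gram_le_trivial :
  \sum_i \sum_j `|(U^T *m U) i j| <= n%:R * m%:R.
Proof.
rewrite -isotropic_total_norm -sum_half_sq; apply: ler_sum => i _.
apply: ler_sum => j _; rewrite mxE; apply: le_trans (ler_norm_sum _ _ _) _.
rewrite -big_split/= mulr_suml; apply: ler_sum => a _.
by rewrite mxE; exact: normr_mul_le_half_sq.
Qed.

Lemma sum_gram_le : (1 < m)%N ->
  \sum_i \sum_j `|(U^T *m U) i j| <=
  n%:R * ((2 + (m%:R - 1) * Num.sqrt (m%:R + 2)) / (m%:R + 1)).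
Proof.
move=> m1; set S := \sum_i _.
pose s i := Num.sqrt (\sum_a U a i ^+ 2).
(* If [s i = 0], division by zero makes [x i] the zero vector; [Ux] still holds because that column
   of [U] vanishes. *)
pose x i a := U a i / s i.
have s0 i : 0 <= s i by exact: sqrtr_ge0.
have s2 i : s i ^+ 2 = \sum_a U a i ^+ 2.
  by rewrite sqr_sqrtr// sumr_ge0// => a _; exact: sqr_ge0.
have Ux i a : U a i = s i * x i a.
  rewrite /x; have [si|si] := eqVneq (s i) 0; last by rewrite mulrC divfK.
  rewrite si mul0r; apply/eqP; rewrite -sqrf_eq0; apply/eqP.
  by apply: (psumr_eq0P (P := xpredT) (F := fun a => U a i ^+ 2)) => // [b _|];
    rewrite ?sqr_ge0// -s2 si expr0n.
have x2 i : \sum_a x i a ^+ 2 = (s i != 0)%:R.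
  rewrite /x; under eq_bigr do rewrite exprMn.
  rewrite -mulr_suml -s2; have [->|si] := eqVneq (s i) 0.
    by rewrite expr0n mul0r.
  by rewrite -exprMn mulfV// expr1n.
pose t i j := \sum_a x i a * x j a.
have tC i j : t i j = t j i by apply: eq_bigr => a _; rewrite mulrC.
have t1 i j : `|t i j| <= 1.
  apply: le_trans (ler_norm_sum _ _ _) _.
  apply: (@le_trans _ _ (\sum_a (x i a ^+ 2 + x j a ^+ 2) / 2)).
    by apply: ler_sum => a _; exact: normr_mul_le_half_sq.
  rewrite -mulr_suml big_split/= !x2.
  by case: (s i != 0); case: (s j != 0) => /=; lra.
have gram i j : `|(U^T *m U) i j| = s i * s j * `|t i j|.
  rewrite -[s i * s j]ger0_norm ?mulr_ge0// -normrM mulr_sumr mxE.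
  congr `|_|; apply: eq_bigr => a _; rewrite mxE !Ux; ring.
pose rho := \sum_i s i.
have rho2 : rho ^+ 2 <= n%:R * m%:R.
  rewrite -isotropic_total_norm -sum_half_sq expr2 mulr_suml.
  apply: ler_sum => i _; rewrite mulr_sumr; apply: ler_sum => j _.
  by rewrite -!s2; exact: mul_le_half_sq.
pose S2 := \sum_i \sum_j s i * s j * t i j ^+ 2.
have S2n : S2 <= n%:R.
  (* AM-GM and the symmetry of [t] lead to this sum. For fixed [j], Parseval turns its part over [i]
     into the squared norm of [x j], at most [1]. *)
  apply: (@le_trans _ _ (\sum_i \sum_j (s i * t i j) ^+ 2)); last first.
    rewrite exchange_big/=.
    apply: (@le_trans _ _ (\sum_(j < n) 1)); last first.
      by rewrite sumr_const card_ord.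
    apply: ler_sum => j _.
    rewrite -[leRHS]/(true%:R) (_ : \sum_i _ = \sum_a x j a ^+ 2); last first.
      rewrite -isotropic_isometry; apply: eq_bigr => i _; congr (_ ^+ 2).
      by rewrite mulr_sumr; apply: eq_bigr => a _; rewrite Ux mulrA.
    by rewrite x2; case: (s j != 0); rewrite ?ler01.
  set W := (leRHS).
  have -> : W = \sum_i \sum_j ((s i * t i j) ^+ 2 + (s j * t i j) ^+ 2) / 2.
    under eq_bigr do rewrite -mulr_suml big_split/=.
    rewrite -mulr_suml big_split/= -/W.
    have -> : \sum_i \sum_j (s j * t i j) ^+ 2 = W.
      rewrite exchange_big/=; apply: eq_bigr => i _; apply: eq_bigr => j _.
      by rewrite tC.
    by field.
  apply: ler_sum => i _; apply: ler_sum => j _.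
  by apply: le_trans (mul_le_half_sq _ _); rewrite expr2 mulrACA.
pose S4 := \sum_i \sum_j s i * s j * t i j ^+ 4.
have S4ge : 3 * rho ^+ 2 <= m%:R * (m%:R + 2) * S4.
  apply: fourth_moment_ge => [|i]; first exact: ltnW.
  by rewrite x2; have [->|] := eqVneq (s i) 0; rewrite ?mul0r ?mulr1.
set M : R := m%:R in rho2 S4ge *.
have M2 : 2 <= M by rewrite ler_nat.
set r := Num.sqrt (M + 2).
have r2 : r ^+ 2 = M + 2 by rewrite sqr_sqrtr//; lra.
have r_ge2 : 2 <= r.
  by rewrite -(@ler_pXn2r _ 2)// ?nnegrE ?sqrtr_ge0// r2; lra.
pose tau := r^-1.
have tau0 : 0 < tau by rewrite invr_gt0; lra.
have tau2 : tau ^+ 2 * (M + 2) = 1 by rewrite -r2 -exprMn mulVf ?expr1n//; lra.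
have main : 2 * tau * (1 + tau) ^+ 2 * S <= tau ^+ 2 * (1 + 2 * tau) * rho ^+ 2 +
    (1 + 2 * tau + 3 * tau ^+ 2) * S2 - S4.
  have -> : rho ^+ 2 = \sum_i \sum_j s i * s j.
    by rewrite expr2 mulr_suml; apply: eq_bigr => i _; rewrite mulr_sumr.
  rewrite /S /S2 /S4 !mulr_sumr -sumrN -!big_split/=.
  apply: ler_sum => i _; rewrite !mulr_sumr -sumrN -!big_split/=.
  apply: ler_sum => j _; rewrite gram.
  have ss : 0 <= s i * s j by rewrite mulr_ge0.
  have := ler_wpM2l ss (normr_le_quartic (ltW tau0) (t1 i j)).
  by lra.
(* This gives the sign of the coefficient of [rho ^+ 2] in [boundM], and would fail for [m = 1]. It
   is immediate for [m >= 3], and [tau = 1 / 2] when [m = 2]. *)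
have tauM : 3 <= (1 + 2 * tau) * M.
  have [M3|M3] := leP 3 M; first by apply: le_trans M3 _; rewrite ler_peMl; lra.
  have m2 : (m <= 2)%N by rewrite -ltnS -(ltr_nat R).
  have mE : M = 2 by rewrite /M (@anti_leq m 2)// m2.
  have -> : tau = 1 / 2; last by rewrite mE; lra.
  apply/eqP; rewrite -(@eqrXn2 _ 2) ?ltW//.
  by apply/eqP; move: tau2; rewrite mE expr_div_n; lra.
have S4M : 3 * tau ^+ 2 * rho ^+ 2 <= M * S4.
  have := ler_wpM2l (sqr_ge0 tau) S4ge.
  have -> : tau ^+ 2 * (M * (M + 2) * S4) = (tau ^+ 2 * (M + 2)) * (M * S4) by ring.
  by rewrite tau2; lra.
(* Scaling [main] by [M] lets [S4M] eliminate [S4]; only [rho2] and [S2n] remain to be inserted. *)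
have boundM : M * (2 * tau * (1 + tau) ^+ 2 * S) <=
    tau ^+ 2 * ((1 + 2 * tau) * M - 3) * rho ^+ 2 +
    (1 + 2 * tau + 3 * tau ^+ 2) * M * S2.
  apply: le_trans (ler_wpM2l _ main) _; first lra.
  by rewrite -subr_ge0; move: S4M; rewrite -subr_ge0; congr (0 <= _); ring.
have bound : 2 * tau * (1 + tau) ^+ 2 * S <=
    n%:R * ((1 + 2 * tau) * (2 - 2 * tau ^+ 2)).
  have M0 : 0 < M by lra.
  rewrite -(ler_pM2l M0); apply: le_trans boundM _.
  have h1 : tau ^+ 2 * ((1 + 2 * tau) * M - 3) * rho ^+ 2 <=
      tau ^+ 2 * ((1 + 2 * tau) * M - 3) * (n%:R * M).
    by apply: ler_wpM2l rho2; rewrite mulr_ge0 ?sqr_ge0// subr_ge0.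
  have h2 : (1 + 2 * tau + 3 * tau ^+ 2) * M * S2 <=
      (1 + 2 * tau + 3 * tau ^+ 2) * M * n%:R.
    by apply: ler_wpM2l S2n; apply: mulr_ge0; have := sqr_ge0 tau; lra.
  apply: le_trans (lerD h1 h2) _; rewrite le_eqVlt; apply/orP; left; apply/eqP.
  have tauME : tau ^+ 2 * M = 1 - 2 * tau ^+ 2 by move: tau2; lra.
  transitivity (n%:R * M * ((1 + 2 * tau) * (tau ^+ 2 * M) + (1 + 2 * tau))).
    by ring.
  by rewrite tauME; ring.
have r0 : r != 0 by lra.
have c0 : 0 < 2 * tau * (1 + tau) ^+ 2.
  by rewrite !mulr_gt0 ?exprn_gt0// addr_gt0.
rewrite -(ler_pM2l c0); apply: le_trans bound _.
rewrite le_eqVlt; apply/orP; left; apply/eqP.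
(* In terms of [r], both bounds on [S] equal [n (r - 1) (r + 2) / (r + 1)]. The denominator [M + 1]
   is [r ^+ 2 - 1], nonzero since [r >= 2]. *)
have -> : M = r ^+ 2 - 2 by rewrite r2; ring.
rewrite /tau; field; apply/andP; split=> //.
have : 4 <= r ^+ 2 by rewrite r2; lra.
by move=> h; apply/negP => /eqP; lra.
Qed.
End IsotropicVectors.

(** * Top eigenvectors of real symmetric matrices *)

Lemma mulmx_tr_ge0 (R : realDomainType) n (v : 'rV[R]_n) : 0 <= (v *m v^T) 0 0.
Proof. by rewrite mxE sumr_ge0// => i _; rewrite mxE -expr2 sqr_ge0. Qed.

Lemma mulmx_tr_eq0 (R : realDomainType) n (v : 'rV[R]_n) :
  ((v *m v^T) 0 0 == 0) = (v == 0).
Proof.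
apply/eqP/eqP => [|->]; last by rewrite mul0mx mxE.
rewrite mxE => /psumr_eq0P h; apply/rowP => i; rewrite mxE; apply/eqP.
rewrite -sqrf_eq0 expr2; have := h _ i isT; rewrite mxE => -> // j _.
by rewrite mxE -expr2 sqr_ge0.
Qed.

(** With [r] the norm of [v], the reflection in the hyperplane orthogonal to [w = v - r *: e] sends
    [v] to [r *: e]; the identity serves when [w = 0]. *)
Lemma householder (R : rcfType) n (v : 'rV[R]_(1 + n)) :
  exists2 Q : 'M[R]_(1 + n), Q *m Q^T = 1%:M &
    exists r, v *m Q^T = r *: delta_mx 0 0.
Proof.
pose r := Num.sqrt ((v *m v^T) 0 0).
have vv : v *m v^T = (r ^+ 2)%:M.
  by rewrite sqr_sqrtr ?mulmx_tr_ge0// [LHS]mx11_scalar.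
pose e : 'rV[R]_(1 + n) := delta_mx 0 0.
have ee : e *m e^T = 1%:M.
  rewrite /e trmx_delta mul_delta_mx.
  by apply/matrixP => i j; rewrite !ord1 !mxE eqxx.
pose w := v - r *: e.
have [w0|w0] := eqVneq w 0.
  exists 1%:M; first by rewrite mul1mx trmx1.
  by exists r; rewrite trmx1 mulmx1; apply/eqP; rewrite -subr_eq0; apply/eqP.
pose q := (w *m w^T) 0 0.
have q0 : q != 0 by rewrite mulmx_tr_eq0.
have ww : w *m w^T = q%:M by rewrite [LHS]mx11_scalar.
pose Q := 1%:M - (2 / q) *: (w^T *m w).
have Qt : Q^T = Q by rewrite /Q linearB/= linearZ/= trmx1 trmx_mul trmxK.
exists Q.
  have : w^T *m w *m (w^T *m w) = q *: (w^T *m w).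
    by rewrite mulmxA -(mulmxA w^T) ww mul_mx_scalar -scalemxAl.
  rewrite Qt /Q; move: (w^T *m w) => W WW.
  rewrite mulmxBr mulmx1 mulmxBl mul1mx -scalemxAl -scalemxAr WW.
  by apply/matrixP => i j; rewrite !mxE; field.
exists r; rewrite Qt /Q -/e.
have [c ve] : exists c, v *m e^T = c%:M.
  by exists ((v *m e^T) 0 0); exact: mx11_scalar.
have ev : e *m v^T = c%:M by rewrite -[LHS]trmxK trmx_mul trmxK ve tr_scalar_mx.
(* As [v] and [r *: e] have equal norms, [<v, w>] is half of [<w, w>], so the reflection subtracts
   exactly [w] from [v]. *)
have vw : v *m w^T = (q / 2)%:M.
  have -> : v *m w^T = (r ^+ 2 - r * c)%:M.
    rewrite /w linearB/= linearZ/= mulmxBr -scalemxAr vv ve scale_scalar_mx.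
    by rewrite raddfB.
  have : w *m w^T = (r ^+ 2 - r * c - (r * c - r * r))%:M.
    rewrite /w [(_ - _)^T]linearB/= [(r *: e)^T]linearZ/= mulmxBr !mulmxBl.
    rewrite -!scalemxAr -!scalemxAl vv ve ev ee !scale_scalar_mx.
    by rewrite -!raddfB /= mulr1; congr (_%:M); ring.
  by move/matrixP/(_ 0 0); rewrite -/q mxE eqxx mulr1n => ->; congr (_%:M); field.
by rewrite mulmxBr mulmx1 -scalemxAr mulmxA vw mul_scalar_mx scalerA mulrA
  divfK ?pnatr_eq0// mulrV ?unitfE// scale1r /w subKr.
Qed.

Lemma symmetric_has_eigenvector (R : realType) n (A : 'M[R]_n.+1) :
  A^T = A -> exists a : R, exists2 v : 'rV[R]_n.+1, v *m A = a *: v & v != 0.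
Proof.
move=> /symmetric_is_spectrum[s hs].
have [_ es] := hs; have := is_spectrum_size hs.
case: s es {hs} => [//|a s] es _; exists a.
apply/eigenvalueP; rewrite eigenvalue_root_char es rootE big_cons.
by rewrite hornerM hornerXsubC subrr mul0r.
Qed.

(** Deflation: a Householder matrix moves an eigenvector to the first axis, and symmetry then splits
    the conjugate of [A] into a 1 x 1 block and a smaller symmetric block. *)
Lemma real_spectral (R : realType) n (A : 'M[R]_n) : A^T = A ->
  exists2 P : 'M[R]_n, P *m P^T = 1%:M & exists d, P *m A *m P^T = diag_mx d.
Proof.
elim: n A => [|n IH] A As.
  exists 1%:M; first by apply/matrixP => -[].
  by exists 0; apply/matrixP => -[].
have [a [v va v0]] := symmetric_has_eigenvector As.
have [Q QQ [r vQ]] := householder v.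
have QQ' : Q^T *m Q = 1%:M by apply: mulmx1C.
have r0 : r != 0.
  apply: contra v0 => /eqP r0; rewrite -[v]mulmx1 -QQ' mulmxA vQ r0 scale0r.
  by rewrite mul0mx.
have [B BE] : exists B : 'M_(1 + n), B = Q *m A *m Q^T by exists (Q *m A *m Q^T).
have Bs : B^T = B by rewrite BE !trmx_mul trmxK As mulmxA.
have eB : delta_mx 0 0 *m B = a *: (delta_mx 0 0 : 'rV_(1 + n)).
  apply: (scalerI r0); rewrite scalemxAl -vQ scalerA [r * a]mulrC -scalerA -vQ.
  by rewrite BE !mulmxA -(mulmxA v) QQ' mulmx1 va scalemxAl.
have B0 j : B 0 j = a * (j == 0)%:R.
  by move/matrixP/(_ 0 j): eB; rewrite -rowE !mxE eqxx/=.
have Bur : ursubmx B = 0.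
  by apply/matrixP => i j; rewrite !mxE ord1 lshift0 B0 mulr0.
have Bdl : dlsubmx B = 0 by rewrite -Bs -trmx_ursub Bur trmx0.
have Bul : ulsubmx B = a%:M.
  by rewrite [LHS]mx11_scalar !mxE !lshift0 B0 eqxx mulr1.
have [P PP [d PB]] : exists2 P : 'M[R]_n, P *m P^T = 1%:M &
    exists d, P *m drsubmx B *m P^T = diag_mx d.
  by apply: IH; rewrite trmx_drsub Bs.
pose P1 : 'M_(1 + n) := block_mx 1%:M 0 0 P.
have PP1 : P1 *m P1^T = 1%:M.
  rewrite /P1 tr_block_mx mulmx_block !trmx0 trmx1.
  by rewrite !mulmx0 !mul0mx mulmx1 !addr0 add0r PP -scalar_mx_block.
have PBP : P1 *m B *m P1^T = diag_mx (row_mx a%:M d : 'rV_(1 + n)).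
  rewrite diag_mx_row -[B]submxK Bur Bdl Bul /P1 tr_block_mx !mulmx_block.
  rewrite !trmx0 trmx1 !mulmx0 !mul0mx !addr0 !mul1mx !mulmx1 !add0r PB.
  congr block_mx; rewrite ?mul0mx ?mulmx0 //.
  by apply/matrixP => i j; rewrite !ord1 !mxE eqxx mulr1n.
exists (P1 *m Q); first by rewrite trmx_mul mulmxA -(mulmxA P1) QQ mulmx1.
exists (row_mx a%:M d : 'rV_(1 + n)).
by rewrite -PBP trmx_mul BE !mulmxA.
Qed.

Lemma gram_rowsub_orthonormal (R : pzRingType) m p n (f : 'I_m -> 'I_p)
    (P : 'M[R]_(p, n)) :
  injective f -> P *m P^T = 1%:M -> rowsub f P *m (rowsub f P)^T = 1%:M.
Proof.
move=> fI PP; rewrite trmx_mxsub mul_rowsub_mx mulmx_colsub PP.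
by apply/matrixP => i j; rewrite !mxE (inj_eq fI).
Qed.

Lemma count_ge_nth (R : realDomainType) (s : seq R) k : sorted >=%R s ->
  (k < size s)%N -> (k < count (fun x => s`_k <= x)%R s)%N.
Proof.
move=> ss ks; rewrite -[X in count _ X](cat_take_drop k.+1 s) count_cat.
apply: leq_trans (leq_addr _ _).
suff /eqP -> : count (fun x => s`_k <= x) (take k.+1 s) == size (take k.+1 s).
  by rewrite size_takel.
rewrite -all_count; apply/(all_nthP 0) => i; rewrite size_takel// => ik.
rewrite nth_take//; apply: (sorted_leq_nth ge_trans (@ge_refl _ _)) => //.
by rewrite inE (leq_trans ik).
Qed.

(** The diagonal of an orthogonal diagonalization is a permutation of the spectrum, since both
    factor the characteristic polynomial. Index [k] counts from 0, hence the [1 + k] rows. *)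
Lemma top_eigenvectors (R : realType) n (A : 'M[R]_n) k : A^T = A -> (k < n)%N ->
  exists2 E : 'M[R]_(1 + k, n), E *m E^T = 1%:M &
  exists2 d, E *m A *m E^T = diag_mx d & forall i, (spectrum A)`_k <= d 0 i.
Proof.
move=> As kn; have [P PP [d PA]] := real_spectral As.
have hs := spectrumP As; have [ss es] := hs; set s := spectrum A in hs ss es *.
have PP' : P^T *m P = 1%:M by exact: mulmx1C.
have [_ Pu] := mulmx1_unit PP'.
have dE : perm_eq s [seq d 0 i | i <- enum 'I_n].
  apply: prod_XsubC_eq; rewrite -es.
  have -> : char_poly A = char_poly (diag_mx d).
    apply: (char_poly_conj Pu); rewrite -PA.
    have -> : invmx P = P^T by rewrite -[RHS]mulmx1 -(mulmxV Pu) mulmxA PP' mul1mx.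
    by rewrite !mulmxA PP' mul1mx -mulmxA PP' mulmx1.
  rewrite char_poly_trig ?diag_mx_is_trig// big_map big_enum/=.
  by apply: eq_bigr => i _; rewrite mxE eqxx mulr1n.
pose J := [pred i | s`_k <= d 0 i].
have kJ : (1 + k <= #|J|)%N.
  rewrite cardE /enum_mem size_filter -enumT.
  have := count_ge_nth ss; rewrite (is_spectrum_size hs) => /(_ k kn).
  by rewrite (permP dE) count_map.
(* Ties can make [J] larger than [1 + k]; any [1 + k] of its elements will do. *)
pose f i := enum_val (widen_ord kJ i).
have fI : injective f by move=> i j /enum_val_inj/(congr1 val)/= ij; exact: val_inj.
exists (rowsub f P); first exact: gram_rowsub_orthonormal.
exists (\row_i d 0 (f i)).
  rewrite trmx_mxsub -mulmxA mul_rowsub_mx mulmx_colsub mulmx_colsub mulmxA PA.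
  by apply/matrixP => i j; rewrite !mxE (inj_eq fI).
by move=> i; rewrite mxE; have := enum_valP (widen_ord kJ i).
Qed.

(* Rotating the top k + 1 eigenvectors so that the first one carries the whole
   component along v leaves k of them orthogonal to v. *)
Lemma top_eigenspace_orthogonal (R : realType) n (A : 'M[R]_n) k (v : 'cV[R]_n) :
  A^T = A -> (k < n)%N ->
  exists U : 'M[R]_(k, n), [/\ U *m U^T = 1%:M, U *m v = 0 &
    (spectrum A)`_k * k%:R <= \tr (U *m A *m U^T)].
Proof.
move=> As kn; have [E EE [d EA dge]] := top_eigenvectors As kn.
have [Q QQ [r vQ]] := householder (E *m v)^T.
pose D := dsubmx Q.
have DD : D *m D^T = 1%:M.
  by rewrite /D dsubmxEsub; apply: gram_rowsub_orthonormal => //; exact: rshift_inj.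
exists (D *m E); split.
- by rewrite trmx_mul mulmxA -(mulmxA D) EE mulmx1.
- have Qv : Q *m (E *m v) = r *: delta_mx 0 0.
    by rewrite -[LHS]trmxK trmx_mul vQ linearZ/= trmx_delta.
  rewrite -mulmxA /D dsubmxEsub mul_rowsub_mx Qv.
  by apply/matrixP => i j; rewrite !mxE /= mulr0.
rewrite trmx_mul !mulmxA -(mulmxA D E) -(mulmxA D (E *m A)) EA.
(* With [k] written as a trace, both sides are sums over the squared entries of [D], weighted by the
   eigenvalues on the right, and compare term by term. *)
have -> : k%:R = \tr (D *m D^T) :> R by rewrite DD mxtrace1.
rewrite /mxtrace mulr_sumr; apply: ler_sum => i _.
rewrite mul_mx_diag !mxE mulr_sumr; apply: ler_sum => a _.
rewrite !mxE mulrAC [_ * d 0 a]mulrC -expr2.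
by apply: ler_wpM2r; rewrite ?sqr_ge0.
Qed.

(** * Graphs *)

(** For [m >= 2] rows, [2 m] times [alpha R m.+1] is exactly the constant of [sum_gram_le]. For one
    row, [alpha R 2] is [1 / 2] and the AM-GM bound [n] suffices. *)
Lemma sum_gram_le_alpha (R : realType) k n (U : 'M[R]_(k.+1, n)) :
  U *m U^T = 1%:M ->
  \sum_i \sum_j `|(U^T *m U) i j| <= 2 * k.+1%:R * (alpha R k.+2 * n%:R).
Proof.
move=> UU; have m0 : k.+1%:R != 0 :> R by rewrite pnatr_eq0.
have k0 : k.+2%:R != 0 :> R by rewrite pnatr_eq0.
have E2 : k.+2%:R = k.+1%:R + 1 :> R by rewrite -natr1.
case: k U UU m0 k0 E2 => [|k] U UU m0 k0 E2.
  apply: le_trans (sum_gram_le_trivial UU) _.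
  by rewrite /alpha subrr mul0r add0r le_eqVlt; apply/orP; left; apply/eqP; field.
apply: le_trans (sum_gram_le UU _) _ => //.
rewrite /alpha E2 in k0 *; rewrite -[_ + 1 + 1]addrA -[1 + 1]/2.
rewrite le_eqVlt; apply/orP; left; apply/eqP.
move: (Num.sqrt _) m0 k0 => r; move: (k.+2%:R) => M M0 M1.
by field; rewrite addrK M0.
Qed.

Lemma lambda_le_alpha (R : realType) k (G : sgraph) : (k.+2 <= #|G|)%N ->
  lambda R k.+2 G <= alpha R k.+2 * #|G|%:R - 1.
Proof.
move=> kG; rewrite /lambda /=.
set A := adjmx R G; set lam := _`_k.+1; set n := #|G| in A lam kG *.
pose v : 'cV[R]_n := const_mx 1.
have [U [UU Uv]] := top_eigenspace_orthogonal v (adjmx_sym R G) kG.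
rewrite -/A -/lam => lamU.
pose S := 2 *: A + 2%:M - v *m v^T.
have SE i j : `|S i j| <= 1.
  rewrite /S /A !mxE big_ord1 !mxE mulr1.
  have [->|ij] := eqVneq i j.
    by rewrite adj_irr mulr0 add0r mulr1n (_ : 2 - 1 = 1) ?normr1//; ring.
  rewrite mulr0n addr0; case: (adj _ _) => /=.
    by rewrite mulr1 (_ : 2 - 1 = 1) ?normr1//; ring.
  by rewrite mulr0 add0r normrN normr1.
have USU : \tr (U *m S *m U^T) = 2 * \tr (U *m A *m U^T) + 2 * k.+1%:R.
  rewrite /S mulmxBr mulmxDr mulmxA Uv mul0mx subr0 -scalemxAr mul_mx_scalar.
  by rewrite mulmxDl -!scalemxAl UU mxtraceD !mxtraceZ mxtrace1.
have trS : \tr (U *m S *m U^T) <= \sum_i \sum_j `|(U^T *m U) i j|.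
  (* Cyclicity of the trace pairs the entries of the Gram matrix [U^T *m U] with those of [S]. *)
  rewrite -mulmxA mxtrace_mulC -mulmxA mxtrace_mulC /mxtrace.
  apply: ler_sum => i _; rewrite mxE; apply: ler_sum => j _.
  apply: le_trans (ler_norm _) _; rewrite normrM.
  by rewrite ler_piMr.
have m0 : 0 < 2 * k.+1%:R :> R by rewrite mulr_gt0 ?ltr0n.
rewrite lerBrDr -(ler_pM2l m0).
apply: le_trans _ (sum_gram_le_alpha UU); apply: le_trans trS.
by rewrite USU; move: lamU; lra.
Qed.

Theorem theorem1p1 (R : realType) (k : nat) (hk : (2 <= k)%N) :
  (forall G : sgraph, (k <= #|G|)%N ->
     lambda R k G <= alpha R k * #|G|%:R - 1) /\
  (c_ R k <= (alpha R k)%:E)%E.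
Proof.
case: k hk => [|[|k]]// _.
split=> [G|]; first exact: lambda_le_alpha.
apply: ge_ereal_sup => _ [_ [G kG ->] <-]; rewrite lee_fin.
have n0 : 0 < #|G|%:R :> R by rewrite ltr0n (leq_trans _ kG).
(* Each ratio is at most [alpha - 1 / n], hence below [alpha]. *)
rewrite ler_pdivrMr//; apply: le_trans (lambda_le_alpha R kG) _.
by rewrite lerBlDr lerDl.
Qed.
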